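(* Let $(X,\mu)$ be a measure space, let $\{H(x):x\in X\}$ be a $\mu$-measurable collection of Hilbert spaces over $\mathbb{F}$ ($\mathbb{F}=\mathbb{R}$ or $\mathbb{F}=\mathbb{C}$), and let $(\varphi_n)_{n=1}^{\infty}$ be an arbitrary orthonormal system in the direct integral $\mathbf{L}_2=\int_X^{\oplus}H(x)\,d\mu(x)$. Put $\nu_k:=2^{2^k}$ for integers $k\ge 0$. Let $(a_n)_{n=1}^{\infty}$ be a sequence of numbers in $\mathbb{F}$ such that $$\sum_{k=0}^{\infty}\Bigl(\sum_{n=\nu_k+1}^{\nu_{k+1}}|a_n|^2\,\log_2^2 n\Bigr)^{1/2}<\infty .$$ Then the series $\sum_{n=1}^{\infty}a_n\varphi_n(x)$ converges unconditionally $\mu$-a.e. on $X$.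
   Context: $X$ is an arbitrary measurable space with a $\sigma$-additive measure $\mu\ge 0$, not assumed finite or $\sigma$-finite. $\{H(x):x\in X\}$ is a collection of Hilbert spaces, either all real or all complex, of arbitrary dimensions; it is called $\mu$-measurable if the function $x\mapsto\dim H(x)$ takes only finitely or countably many values (cardinal numbers) and all the sets $\{x\in X:\dim H(x)=\mathrm{const}\}$ are $\mu$-measurable. The direct integral $\mathbf{L}_2=\int_X^{\oplus}H(x)\,d\mu(x)$ is the Hilbert space with inner product $(f,g)_2=\int_X(f(x),g(x))_{H(x)}\,d\mu(x)$ and norm $\|\cdot\|_2$. In the standard way: on each set $X_\kappa=\{x:\dim H(x)=\kappa\}$ the spaces $H(x)$ are identified with one fixed Hilbert space $H_\kappa$ of dimension $\kappa$, and $\mathbf{L}_2$ consists of the classes of $\mu$-equivalent functions $f$ on $X$ with $f(x)\in H(x)$, whose restriction to each $X_\kappa$ is a strongly $\mu$-measurable $H_\kappa$-valued function, and with $\|f\|_2^2=\int_X\|f(x)\|_{H(x)}^2\,d\mu(x)<\infty$. In particular, if $H(x)\equiv H$ is constant, then $\mathbf{L}_2=L_2(X,d\mu;H)$, the space of classes of strongly $\mu$-measurable square-integrable functions $f:X\to H$. The series $\sum_{n=1}^{\infty}a_n\varphi_n(x)$ is called unconditionally convergent $\mu$-a.e. on $X$ if, for every permutation $\sigma$ of the set $\mathbb{N}$ of all positive integers, the series $\sum_{n=1}^{\infty}a_{\sigma(n)}\varphi_{\sigma(n)}(x)$ converges in the norm of $H(x)$ for $\mu$-almost every $x\in X$; the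 measure-zero exceptional set may depend on $\sigma$. Notation: $\log_2^2 n=(\log_2 n)^2$. *)

(* Defs.v *)
From HB Require Import structures.
From mathcomp Require Import all_boot all_order all_algebra.
From mathcomp Require Import sesquilinear complex.
From mathcomp Require Import all_classical all_reals all_analysis.

Set Implicit Arguments.
Unset Strict Implicit.
Unset Printing Implicit Defensive.

Import Order.TTheory GRing.Theory Num.Theory.
Import numFieldNormedType.Exports.

Local Open Scope classical_set_scope.
Local Open Scope card_scope.
Local Open Scope ring_scope.

Inductive scalar_kind := RealScalars | ComplexScalars.

Definition scalar_field (R : realType) (k : scalar_kind) : numFieldType :=
  match k with
  | RealScalars => R
  | ComplexScalars => R[i]
  end.

Definition scalar_conj (R : realType) (k : scalar_kind) :
    scalar_field R k -> scalar_field R k :=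
  match k with
  | RealScalars => fun z => z
  | ComplexScalars => fun z : R[i] => Num.conj z
  end.

Definition scalar_re (R : realType) (k : scalar_kind) : scalar_field R k -> R :=
  match k with
  | RealScalars => fun z => z
  | ComplexScalars => fun z : R[i] => complex.Re z
  end.

(* Norms on modules over [scalar_field R k] take values in the nonnegative elements
   of [scalar_field R k] itself; [rnorm] is the same number as an element of [R]. *)
Definition rnorm (R : realType) (k : scalar_kind)
    (V : normedModType (scalar_field R k)) (v : V) : R :=
  scalar_re `|v|.

Definition rmodulus (R : realType) (k : scalar_kind) (z : scalar_field R k) : R :=
  scalar_re `|z|.

Definition scalar_integral (R : realType) (k : scalar_kind)
    (d : measure_display) (X : measurableType d)
    (mu : {measure set X -> \bar R}) : (X -> scalar_field R k) -> scalar_field R k :=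
  match k with
  | RealScalars => fun h => Rintegral mu setT h
  | ComplexScalars => fun h : X -> R[i] =>
      Complex (Rintegral mu setT (fun x => complex.Re (h x)))
              (Rintegral mu setT (fun x => complex.Im (h x)))
  end.

Record hilbertType (R : realType) (k : scalar_kind) := Hilbert {
  hilbert_sort :> completeNormedModType (scalar_field R k) ;
  hdot : {dot hilbert_sort for (@scalar_conj R k)} ;
  hdotE : forall v : hilbert_sort, hdot v v = `|v| ^+ 2
}.
Arguments hdot {R k} h.

Section HilbertDimension.
Variables (R : realType) (k : scalar_kind).
Implicit Types H : hilbertType R k.

Definition orthonormal_set H (B : set H) : Prop :=
  forall u v, B u -> B v -> hdot H u v = (u == v)%:R.

Definition orthonormal_basis H (B : set H) : Prop :=
  orthonormal_set B /\
  forall v, (forall u, B u -> hdot H v u = 0) -> v = 0.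

(* Orthonormal bases of a Hilbert space exist and all have the same
   cardinality, the dimension of the space; one of them is chosen here. *)
Definition hbasis H : set H := xget set0 [set B | orthonormal_basis B].

Definition same_dim H1 H2 : Prop := @hbasis H1 #= @hbasis H2.

Definition unitary H1 H2 (U : {linear H1 -> H2}) : Prop :=
  (forall u v, hdot H2 (U u) (U v) = hdot H1 u v) /\ range U = setT.

End HilbertDimension.

Section DirectIntegral.
Context (R : realType) (k : scalar_kind) (d : measure_display)
  (X : measurableType d) (mu : {measure set X -> \bar R}).

(* Measurability with respect to the completion of [mu]. *)
Definition mu_measurable (A : set X) : Prop :=
  exists2 B : set X, measurable B & mu.-negligible (A `+` B).

Variable H : X -> hilbertType R k.

Definition dim_class (x : X) : set X := [set y | same_dim (H y) (H x)].

(* The classes [dim_class x] are in bijection with the values of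
   [x |-> dim H(x)]. *)
Definition measurable_collection : Prop :=
  countable (range dim_class) /\
  forall x, mu_measurable (dim_class x).

(* Cardinals are represented by the classes [X_kappa] themselves: to the class
   [A] corresponds the fixed space [model A], onto which every [H x] with
   [dim_class x = A] is identified by [ident A x]. The values of [model A] and
   [ident A x] for other pairs [A, x] are irrelevant. *)
Record identification := Identification {
  model : set X -> hilbertType R k ;
  ident : forall (A : set X) (x : X), {linear H x -> model A} ;
  ident_unitary : forall x, unitary (ident (dim_class x) x)
}.

(* [f] is strongly [mu]-measurable on [D]: it is there the [mu]-a.e. limit of
   measurable functions with finitely many values. Their nonzero level sets may
   have infinite measure; for square-integrable [f] requiring finite measure
   would define the same class. *)
Definition strongly_measurable (V : hilbertType R k) (D : set X)
    (f : X -> V) : Prop :=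
  exists s : nat -> {fimfun X >-> V},
    (forall n v, measurable (s n @^-1` [set v])) /\
    {ae mu, forall x, D x -> (fun n => s n x) @ \oo --> f x}.

Definition section := forall x, H x.

Variable E : identification.

(* Sections stand for their classes of [mu]-equivalence. *)
Definition L2 (f : section) : Prop :=
  (forall x, strongly_measurable (dim_class x)
               (fun y => ident E (dim_class x) y (f y))) /\
  (\int[mu]_x ((rnorm (f x)) ^+ 2)%:E < +oo)%E.

Definition L2dot (f g : section) : scalar_field R k :=
  scalar_integral mu (fun x => hdot (H x) (f x) (g x)).

(* The terms of index [0] of sequences are ignored, here and below. *)
Definition orthonormal_system (phi : nat -> section) : Prop :=
  (forall n, (0 < n)%N -> L2 (phi n)) /\
  forall m n, (0 < m)%N -> (0 < n)%N -> L2dot (phi m) (phi n) = (m == n)%:R.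

Definition unconditionally_cvg_ae (u : nat -> section) : Prop :=
  forall sigma : nat -> nat,
    set_bij [set n | (0 < n)%N] [set n | (0 < n)%N] sigma ->
    {ae mu, forall x,
      cvg ((fun N => \sum_(1 <= n < N.+1) u (sigma n) x) @ \oo)}.

End DirectIntegral.

Definition log2 (R : realType) (x : R) : R := ln x / ln 2.

Definition nu (k : nat) : nat := 2 ^ (2 ^ k).

(* Main.v *)
(* Let [u n = a n *: phi n]. For a list [s] of at most [2 ^ r] indices, every
   partial sum of [u] along [s] is a sum of at most [r + 1] dyadic pieces of [s],
   so [(r + 1) * dyadic q r s], where [q] is the squared norm of the sum over a
   list, dominates the squared norms of all partial sums; by orthogonality its
   integral is [(r + 1) ^ 2] times the sum of the [|a n| ^ 2]
   (Rademacher-Menshov). A rearrangement enumerates each block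
   [nu k < n <= nu k.+1] in some order, and there [r = 2 ^ k.+1] is comparable to
   [log2 n]. Hence the maximal partial sums of the blocks have summable [L2]
   norms, so they are summable almost everywhere, which gives the Cauchy property
   because every block is exhausted after finitely many terms.

   All measurability takes place off one null set [N], outside which the sections
   [phi n] are pointwise limits of simple maps and the classes of constant
   dimension are measurable. *)

Require Import Defs.
From HB Require Import structures.
From mathcomp Require Import all_boot all_order all_algebra.
From mathcomp Require Import sesquilinear complex.
From mathcomp Require Import all_classical all_reals all_analysis.
From mathcomp Require Import measurable_realfun.
From mathcomp Require Import ring lra.

Set Implicit Arguments.
Unset Strict Implicit.
Unset Printing Implicit Defensive.

Import Order.TTheory GRing.Theory Num.Theory.
Import numFieldNormedType.Exports.

Local Open Scope classical_set_scope.
Local Open Scope ring_scope.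

(** * Scalars, norms and inner products *)

Section Scalars.
Context (R : realType) (F : scalar_kind).
Local Notation K := (scalar_field R F).
Implicit Types x y z : K.

Lemma scalar_reD x y : scalar_re (x + y) = scalar_re x + scalar_re y.
Proof. by case: F x y => // -[a b] [c d]. Qed.

Lemma scalar_re1 : scalar_re (1 : K) = 1.
Proof. by case: F. Qed.

Lemma scalar_re_conj x : scalar_re (scalar_conj x) = scalar_re x.
Proof. by case: F x => // -[a b]. Qed.

Lemma ler_scalar_re x y : x <= y -> scalar_re x <= scalar_re y.
Proof. by case: F x y => // x y /=; rewrite lecE => /andP[]. Qed.

Lemma ltr_scalar_re x y : x < y -> scalar_re x < scalar_re y.
Proof. by case: F x y => // x y /=; rewrite ltcE => /andP[]. Qed.

(** Nonnegative complex numbers have zero imaginary part, so their real parts decide the order. *)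
Lemma scalar_re_ltr x y :
  0 <= x -> 0 <= y -> scalar_re x < scalar_re y -> x < y.
Proof.
by case: F x y => // x y /= /ger0_Im x0 /ger0_Im y0 xy; rewrite ltcE x0 y0 eqxx.
Qed.

Lemma scalar_reM x y : 0 <= x -> scalar_re (x * y) = scalar_re x * scalar_re y.
Proof.
by case: F x y => // x [c d] /= /ger0_Im; case: x => a b /= ->; rewrite mul0r subr0.
Qed.

Lemma scalar_mul_conj x : x * scalar_conj x = `|x| ^+ 2.
Proof.
case: F x => [x|x] /=; first by rewrite real_normK ?num_real.
by rewrite sqr_normc.
Qed.

Lemma scalar_re_nat n : scalar_re (n%:R : K) = n%:R.
Proof. by elim: n => [|n IH]; [case: F|rewrite -!natr1 scalar_reD IH scalar_re1]. Qed.

Lemma scalar_re0 : scalar_re (0 : K) = 0. Proof. exact: (scalar_re_nat 0). Qed.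

Lemma scalar_re_surj (e : R) : 0 < e -> exists2 x : K, 0 < x & scalar_re x = e.
Proof.
case: F => e0; first by exists e.
by exists (e%:C)%C => //=; rewrite ltcE /= eqxx.
Qed.

Lemma rmodulus_ge0 x : 0 <= rmodulus x.
Proof. by rewrite -scalar_re0; apply/ler_scalar_re. Qed.

Section Norm.
Variable V : normedModType K.
Implicit Types u v : V.

Lemma rnorm_ge0 v : 0 <= rnorm v.
Proof. by rewrite -scalar_re0; apply/ler_scalar_re. Qed.

Lemma ler_rnormD u v : rnorm (u + v) <= rnorm u + rnorm v.
Proof. by rewrite -scalar_reD; apply/ler_scalar_re/ler_normD. Qed.

Lemma rnormN v : rnorm (- v) = rnorm v.
Proof. by rewrite /rnorm normrN. Qed.

Lemma rnorm0 : rnorm (0 : V) = 0.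
Proof. by rewrite /rnorm normr0 scalar_re0. Qed.

Lemma rnormZ c v : rnorm (c *: v) = rmodulus c * rnorm v.
Proof. by rewrite /rnorm normrZ scalar_reM. Qed.

Lemma ler_rnorm_sum (I : Type) (s : seq I) (P : pred I) (f : I -> V) :
  rnorm (\sum_(i <- s | P i) f i) <= \sum_(i <- s | P i) rnorm (f i).
Proof.
elim/big_rec2 : _ => [|i y x _ yx]; first by rewrite rnorm0.
by rewrite (le_trans (ler_rnormD _ _))// lerD2l.
Qed.

Lemma ler_rnorm_dist u v : `|rnorm u - rnorm v| <= rnorm (u - v).
Proof.
have uv := ler_rnormD (u - v) v; rewrite subrK in uv.
have vu := ler_rnormD (v - u) u; rewrite subrK in vu.
rewrite -(rnormN (v - u)) opprB in vu.
by rewrite ler_norml; lra.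
Qed.

Lemma ltr_norm_rnorm v (e : K) : 0 < e -> rnorm v < scalar_re e -> `|v| < e.
Proof. by move=> /ltW e0; apply: scalar_re_ltr. Qed.

Lemma cvg_rnorm (s : nat -> V) v :
  s @ \oo --> v -> (fun n => rnorm (s n)) @ \oo --> rnorm v.
Proof.
move=> sv; apply/cvgrPdist_lt => e e0.
have [e' e'0 <-] := scalar_re_surj e0.
move/cvgrPdist_lt : sv => /(_ _ e'0); apply: filterS => n /ltr_scalar_re.
exact/le_lt_trans/ler_rnorm_dist.
Qed.

End Norm.

Section Dot.
Variable H : hilbertType R F.
Implicit Types u v w : H.

(** The real part is symmetric and additive in each argument over either field, so squared norms
    expand without conjugates. *)
Definition rdot u v : R := scalar_re (hdot H u v).

Lemma rdotDl u v w : rdot (u + v) w = rdot u w + rdot v w.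
Proof. by rewrite /rdot linearDl scalar_reD. Qed.

Lemma rdotDr u v w : rdot u (v + w) = rdot u v + rdot u w.
Proof. by rewrite /rdot linearDr scalar_reD. Qed.

Lemma rdotC u v : rdot u v = rdot v u.
Proof. by rewrite /rdot (hermitian_subproof u v) expr0 mul1r scalar_re_conj. Qed.

Lemma rnorm_sqr v : rnorm v ^+ 2 = rdot v v.
Proof. by rewrite /rdot hdotE expr2 scalar_reM// -expr2. Qed.

Lemma rnormD_sqr u v :
  rnorm (u + v) ^+ 2 = rnorm u ^+ 2 + 2 * rdot u v + rnorm v ^+ 2.
Proof. by rewrite !rnorm_sqr !(rdotDl, rdotDr) (rdotC v u); ring. Qed.

Lemma hdotZ (c c' : K) u v :
  hdot H (c *: u) (c' *: v) = c * scalar_conj c' * hdot H u v.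
Proof. by rewrite linearZl_LR linearZr_LR /= mulrA. Qed.

End Dot.

Lemma rnorm_unitary (H1 H2 : hilbertType R F) (U : {linear H1 -> H2}) v :
  unitary U -> rnorm (U v) = rnorm v.
Proof.
move=> [Udot _]; apply/eqP; rewrite -(@eqrXn2 _ 2) ?rnorm_ge0//.
by rewrite !rnorm_sqr /rdot Udot.
Qed.

End Scalars.

(** * Integrals off a null set *)

Section NullSets.
Context (R : realType) (d : measure_display) (X : measurableType d)
  (mu : {measure set X -> \bar R}).
Variable N : set X.
Hypotheses (mN : measurable N) (N0 : mu N = 0%E).

Let mD : measurable (~` N). Proof. exact: measurableC. Qed.

Import HBNNSimple.

(* No measurability of [f] is required: the integral of a nonnegative function
   is a supremum over the simple functions below it. *)
Lemma integral_setC_null (f : X -> \bar R) :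
  (\int[mu]_x f x = \int[mu]_(x in ~` N) f x)%E.
Proof.
suff ge0 (g : X -> \bar R) : (forall x, 0 <= g x)%E ->
    (\int[mu]_x g x = \int[mu]_(x in ~` N) g x)%E.
  by rewrite integralE [RHS]integralE !ge0.
move=> g0; rewrite ge0_integralTE// ge0_integralE//.
apply/eqP; rewrite eq_le; apply/andP; split; last first.
  apply: le_ereal_sup => _ [h hg <-]; exists h => // x.
  by apply: (le_trans (hg x)); rewrite /patch; case: ifP.
(* A simple [h] below [g] keeps its integral when cut off to the complement of [N], and the cut-off
   function lies below [g] restricted to that set. *)
apply: ge_ereal_sup => _ [h hg <-].
rewrite -integralT_nnsfun (ge0_negligible_integral mN)//; last 2 first.
- by apply/measurable_EFinP; exact: measurable_funPT.
- by move=> x _; rewrite lee_fin.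
rewrite setTD integral_nnsfun//.
apply: ereal_sup_ubound; exists (proj_nnsfun h mD) => /=.
  move=> x; have := hg x; rewrite mindicE /patch.
  by case: ifP; rewrite ?mulr1 ?mulr0.
apply: eq_sintegral => x; rewrite /= mindicE /patch.
by case: ifP; rewrite ?mulr1 ?mulr0.
Qed.

Lemma Rintegral_setC_null (f : X -> R) :
  \int[mu]_x f x = \int[mu]_(x in ~` N) f x.
Proof. by rewrite /Rintegral integral_setC_null. Qed.

(** Real and imaginary parts are integrated separately. Their integrability is the hypothesis at
    [c' = 1] and [c' = -i], since Re (-i z) = Im z. *)
Lemma scalar_re_integral (F : scalar_kind) (h : X -> scalar_field R F)
    (c : scalar_field R F) :
  (forall c', mu.-integrable (~` N)
     (fun x => (scalar_re (c' * h x))%:E)) ->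
  scalar_re (c * scalar_integral mu h) =
  \int[mu]_(x in ~` N) scalar_re (c * h x).
Proof.
case: F h c => /= h c hint; rewrite !Rintegral_setC_null.
  rewrite RintegralZl//; have := hint 1.
  by under eq_fun do rewrite mul1r.
have re_int : mu.-integrable (~` N) (fun x => (complex.Re (h x))%:E).
  by have := hint 1; under eq_fun do rewrite mul1r.
have im_int : mu.-integrable (~` N) (fun x => (complex.Im (h x))%:E).
  have := hint (- 'i)%C; congr (_.-integrable _ _); apply/funext => x.
  by congr EFin; case: (h x) => a b /=; rewrite oppr0 mul0r sub0r mulN1r opprK.
case: c => a b /=.
have mulE x : complex.Re ((a +i* b)%C * h x) =
    a * complex.Re (h x) - b * complex.Im (h x) by case: (h x).
under [RHS]eq_Rintegral do rewrite mulE.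
by rewrite RintegralB//= ?RintegralZl//;
  [exact: (integrableZl mD a re_int)|exact: (integrableZl mD b im_int)].
Qed.

End NullSets.

(** * Measurable sections *)

(** An injection of [P] into the naturals indexes the sets, and numbers outside its image get the
    empty set. This carries facts on sequences of sets over to the dimension classes. *)
Lemma countable_bigcup_nat (T : choiceType) (U : Type) (P : set T) (G : T -> set U) :
  countable P ->
  exists F : nat -> set U, \bigcup_(a in P) G a = \bigcup_n F n /\
    forall n, F n = set0 \/ exists2 a, P a & F n = G a.
Proof.
move=> /countable_injP[f injf].
exists (fun n => \bigcup_(a in P `&` f @^-1` [set n]) G a); split.
  apply/seteqP; split => [x [a Pa Gax]|x [n _ [a [Pa _] Gax]]]; last by exists a.
  by exists (f a) => //; exists a.
move=> n; have [[a [Pa fa]]|noa] := pselect (exists a, P a /\ f a = n).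
  right; exists a => //; apply/seteqP; split => [x [b [Pb fb]] Gbx|x Gax].
    by rewrite (_ : a = b)//; apply: injf; rewrite ?inE// fb.
  by exists a.
left; rewrite -subset0 => x [a [Pa fa] _]; apply: noa; by exists a.
Qed.

Lemma negligible_countable_bigcup (R : realType) d (X : measurableType d)
    (mu : {measure set X -> \bar R}) (T : choiceType) (P : set T)
    (G : T -> set X) :
  countable P -> (forall a, P a -> mu.-negligible (G a)) ->
  mu.-negligible (\bigcup_(a in P) G a).
Proof.
move=> /countable_bigcup_nat-/(_ _ G)[F [-> FE]] G0.
apply: negligible_bigcup => n.
by have [->|[a Pa ->]] := FE n; [exact: negligible_set0|exact: G0].
Qed.

Lemma measurable_fun_countable_bigcup d d' (X : measurableType d)
    (Y : measurableType d') (T : choiceType) (P : set T) (G : T -> set X)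
    (f : X -> Y) :
  countable P -> (forall a, P a -> measurable (G a)) ->
  (forall a, P a -> measurable_fun (G a) f) ->
  measurable_fun (\bigcup_(a in P) G a) f.
Proof.
move=> /countable_bigcup_nat-/(_ _ G)[F [-> FE]] mG mf.
apply/measurable_fun_bigcup => n.
  by have [->|[a Pa ->]] := FE n; [exact: measurable0|exact: mG].
by have [->|[a Pa ->]] := FE n; [exact: measurable_fun_set0|exact: mf].
Qed.

Section SimpleMap.
Context d (X : measurableType d).

(** The codomain carries no structure, so pairs of simple maps and their images under arbitrary
    functions stay simple, with no sigma-algebra on the Hilbert spaces. *)
Definition simple_map (V : Type) (s : X -> V) :=
  finite_set (range s) /\ forall v, measurable (s @^-1` [set v]).

Lemma simple_map_preimage (V : Type) (s : X -> V) (A : set V) :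
  simple_map s -> measurable (s @^-1` A).
Proof.
move=> [fs ms].
rewrite (_ : _ @^-1` _ = \bigcup_(v in range s `&` A) (s @^-1` [set v])).
  by apply: fin_bigcup_measurable => //; exact: finite_setIl.
apply/seteqP; split => [x Asx|x [v [_ Av] /= ->//]].
by exists (s x).
Qed.

Lemma simple_map_pair (V W : Type) (s : X -> V) (t : X -> W) :
  simple_map s -> simple_map t -> simple_map (fun x => (s x, t x)).
Proof.
move=> [fs ms] [ft mt]; split.
  apply: sub_finite_set (finite_setX fs ft).
  by move=> _ [x _ <-]; split; exists x.
move=> [v w].
rewrite (_ : _ @^-1` _ = s @^-1` [set v] `&` t @^-1` [set w]).
  exact: measurableI.
by apply/seteqP; split => x /= [-> ->].
Qed.

Lemma simple_map_comp (V W : Type) (g : V -> W) (s : X -> V) :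
  simple_map s -> simple_map (fun x => g (s x)).
Proof.
move=> ss; split; last first.
  by move=> w; exact: (simple_map_preimage (g @^-1` [set w]) ss).
have := finite_image g ss.1; apply: sub_finite_set.
by move=> _ [x _ <-]; exists (s x) => //; exists x.
Qed.

Lemma simple_map_cst (V : Type) (v : V) : simple_map (fun=> v : V).
Proof.
split => [|w]; first by apply: sub_finite_set (finite_set1 v) => _ [x _ <-].
by rewrite preimage_cst; case: ifP.
Qed.

Lemma measurable_simple_map d' (Y : measurableType d') (s : X -> Y) D :
  simple_map s -> measurable_fun D s.
Proof.
by move=> ss mD A _; apply: measurableI => //; exact: simple_map_preimage.
Qed.

End SimpleMap.

Section Sections.
Context (R : realType) (F : scalar_kind) (d : measure_display)
  (X : measurableType d) (mu : {measure set X -> \bar R})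
  (H : X -> hilbertType R F) (E : identification H).
Implicit Types (N : set X) (f g : section H).

Lemma dim_class_eq x y : dim_class H x y -> dim_class H y = dim_class H x.
Proof.
move=> xy; apply/seteqP; split => z; rewrite /dim_class /= /same_dim => zy.
  exact: card_eq_trans zy xy.
by apply: card_eq_trans zy _; rewrite card_eq_sym.
Qed.

Lemma dim_class_refl x : dim_class H x x.
Proof. exact: card_eqxx. Qed.

Lemma rnorm_ident A x v :
  range (dim_class H) A -> A x -> rnorm (ident E A x v) = rnorm v.
Proof.
move=> [y _ <-] yx; rewrite -(dim_class_eq yx).
exact/rnorm_unitary/ident_unitary.
Qed.

(* Off [N], [f] is strongly measurable on each class in the exact sense:
   convergence holds everywhere, not just almost everywhere. *)
Definition msection N f := forall A, range (dim_class H) A ->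
  exists s : nat -> X -> model E A, (forall n, simple_map (s n)) /\
    forall x, (A `\` N) x -> (fun n => s n x) @ \oo --> ident E A x (f x).

Lemma msectionZD N c f g : msection N f -> msection N g ->
  msection N (fun x => c *: f x + g x).
Proof.
move=> mf mg A rA; have [s [ss sf]] := mf A rA; have [t [st tg]] := mg A rA.
exists (fun n x => c *: s n x + t n x); split => [n|x Ax].
  exact: (simple_map_comp (fun p => c *: p.1 + p.2)
    (simple_map_pair (ss n) (st n))).
rewrite linearP; apply: cvgD; last exact: tg.
by apply: cvgZr; exact: sf.
Qed.

(** Identifications preserve norms, so on each class the norm is a pointwise limit of norms of
    simple maps; countably many classes cover the complement of [N]. *)
Lemma measurable_rnorm N f : countable (range (dim_class H)) ->
  (forall A, range (dim_class H) A -> measurable (A `\` N)) ->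
  msection N f -> measurable_fun (~` N) (fun x => rnorm (f x)).
Proof.
move=> cH mA mf.
rewrite (_ : ~` N = \bigcup_(A in range (dim_class H)) (A `\` N)); last first.
  apply/seteqP; split => [x Nx|x [A _ [_ Nx]]//].
  by exists (dim_class H x) => //; split => //; exact: dim_class_refl.
apply: measurable_fun_countable_bigcup => // A rA.
have [s [ss sf]] := mf A rA.
apply: (@measurable_fun_cvg _ _ _ _ (fun n x => rnorm (s n x))) => [n|x Ax].
  exact/measurable_simple_map/simple_map_comp/ss.
by rewrite -(rnorm_ident _ rA Ax.1); exact/cvg_rnorm/sf.
Qed.

(** [N] absorbs, over countably many classes, the difference between the class and a measurable set,
    and the points where the simple maps approximating some [phi n] fail to converge. *)
Lemma exists_null_set (phi : nat -> section H) (P : set nat):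
  measurable_collection mu H ->
  (forall n, P n -> forall x, strongly_measurable mu (dim_class H x)
               (fun y => ident E (dim_class H x) y (phi n y))) ->
  exists N, [/\ measurable N, mu N = 0%E,
    forall A, range (dim_class H) A -> measurable (A `\` N) &
    forall n, P n -> msection N (phi n)].
Proof.
move=> [cH mH] mphi.
(* Stated for every [A], vacuously off the range, so that [choice] yields a function [NA]. *)
have exc A : exists NA : set X, range (dim_class H) A ->
    [/\ mu.-negligible NA, exists2 B, measurable B & (A `+` B) `<=` NA &
    forall n, P n -> exists s : nat -> X -> model E A,
      (forall n, simple_map (s n)) /\
      forall x, (A `\` NA) x -> (fun n => s n x) @ \oo --> ident E A x (phi n x)].
  have [[x _ <-]|nA] := pselect (range (dim_class H) A); last by exists set0.
  have [B mB nB] := mH x.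
  have /choice[s sP] : forall n, exists s : nat -> X -> model E (dim_class H x),
      P n -> (forall n, simple_map (s n)) /\ {ae mu, forall y, dim_class H x y ->
      (fun n => s n y) @ \oo --> ident E (dim_class H x) y (phi n y)}.
    move=> n; have [Pn|nPn] := pselect (P n); last by exists (fun _ _ => 0).
    have [s [ms sphi]] := mphi n Pn x.
    exists (fun m => s m) => _; split; last exact: sphi.
    by move=> m; split; [exact: fimfunP|exact: ms].
  pose bad n := [set y | P n /\ ~ (dim_class H x y ->
     (fun m => s n m y) @ \oo --> ident E (dim_class H x) y (phi n y))].
  exists ((dim_class H x `+` B) `|` \bigcup_n bad n) => _; split.
  - apply: negligibleU => //; apply: negligible_bigcup => n.
    have [Pn|nPn] := pselect (P n); last first.
      by apply: negligibleS (negligible_set0 mu) => y [].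
    have [_] := sP n Pn; apply: negligibleS => y [_ //].
  - by exists B => //; exact: subsetUl.
  - move=> n Pn; exists (s n); split; first exact: (sP n Pn).1.
    move=> y [xy /not_orP[_ nbad]]; apply: contrapT => ns; apply: nbad.
    by exists n => //; split => // /(_ xy).
have [NA NAP] := choice exc.
have : mu.-negligible (\bigcup_(A in range (dim_class H)) NA A).
  by apply: negligible_countable_bigcup => // A /NAP[].
move=> [N [mN N0 NAN]]; exists N; split => // [A rA|n Pn A rA].
  have [_ [B mB ABN] _] := NAP A rA.
  rewrite (_ : A `\` N = B `\` N); first exact: measurableD.
  have {}ABN x : (A `+` B) x -> N x by move=> /ABN ?; apply: NAN; exists A.
  apply/seteqP; split => x [Ax Nx]; split => //; apply: contrapT => Bx; apply: Nx.
    by apply: ABN; left.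
  by apply: ABN; right.
have [_ _ /(_ n Pn)[s [ss sphi]]] := NAP A rA; exists s; split => // x [Ax Nx].
by apply: sphi; split => // NAx; apply: Nx; apply: NAN; exists A.
Qed.

End Sections.

(** * Orthogonality *)

Section SquareIntegrable.
Context (R : realType) (F : scalar_kind) (d : measure_display)
  (X : measurableType d) (mu : {measure set X -> \bar R})
  (H : X -> hilbertType R F) (E : identification H) (N : set X).
Hypotheses (mN : measurable N) (N0 : mu N = 0%E)
  (cH : countable (range (dim_class H)))
  (mH : forall A, range (dim_class H) A -> measurable (A `\` N)).
Implicit Types (f g h : section H).

Let mD : measurable (~` N). Proof. exact: measurableC. Qed.

Definition sq_integrable f := msection E N f /\
  mu.-integrable (~` N) (fun x => (rnorm (f x) ^+ 2)%:E).

Lemma eq_sq_integrable f g :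
  (forall x, f x = g x) -> sq_integrable f -> sq_integrable g.
Proof. by move=> fg; have -> : f = g by exact: functional_extensionality_dep. Qed.

Lemma sq_integrableZD c f g : sq_integrable f -> sq_integrable g ->
  sq_integrable (fun x => c *: f x + g x).
Proof.
move=> [mf If] [mg Ig]; split; first exact: msectionZD.
(* The dominating function comes from (p q + r)^2 <= 2 p^2 q^2 + 2 r^2. *)
have Ik := integrableD mD (integrableZl mD (2 * rmodulus c ^+ 2) If)
  (integrableZl mD 2 Ig).
apply: le_integrable Ik => //.
  apply/measurable_EFinP/measurable_funX.
  exact: measurable_rnorm cH mH (msectionZD c mf mg).
move=> x _ /=; rewrite lee_fin !ger0_norm ?addr_ge0 ?mulr_ge0 ?rnorm_ge0
  ?rmodulus_ge0//.
have := ler_rnormD (c *: f x) (g x); rewrite rnormZ.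
set p := rmodulus c; set q := rnorm (f x); set r := rnorm (g x) => le.
apply: (@le_trans _ _ ((p * q + r) ^+ 2)).
  by rewrite ler_sqr ?nnegrE ?rnorm_ge0// (le_trans _ le) ?rnorm_ge0.
have := sqr_ge0 (p * q - r); lra.
Qed.

Lemma sq_integrable0 : sq_integrable (fun=> 0).
Proof.
split=> [A rA|]; last first.
  under eq_fun do rewrite rnorm0 expr0n.
  exact: integrable0.
exists (fun _ _ => 0); split => [_|x Ax]; last by rewrite linear0; exact: cvg_cst.
exact: simple_map_cst.
Qed.

Lemma sq_integrableZ c f : sq_integrable f -> sq_integrable (fun x => c *: f x).
Proof.
move=> /(sq_integrableZD c)/(_ sq_integrable0).
by apply: eq_sq_integrable => x; rewrite addr0.
Qed.

Lemma sq_integrableD f g : sq_integrable f -> sq_integrable g ->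
  sq_integrable (fun x => f x + g x).
Proof.
move=> /(sq_integrableZD 1) If /If.
by apply: eq_sq_integrable => x; rewrite scale1r.
Qed.

(** By polarization the inner product is half of |f + g|^2 - |f|^2 - |g|^2, and each of these terms
    is integrable. *)
Lemma integrable_rdot f g : sq_integrable f -> sq_integrable g ->
  mu.-integrable (~` N) (fun x => (rdot (f x) (g x))%:E).
Proof.
move=> If Ig; have [_ Ifg] := sq_integrableD If Ig.
have := integrableZl mD (1 / 2) (integrableB mD (integrableB mD Ifg If.2) Ig.2).
congr (_.-integrable _ _); apply/funext => x /=.
by rewrite -!EFinB -EFinM rnormD_sqr; congr EFin; field.
Qed.

(** This passes from the scalar-valued [L2dot] over all of [X] to real integrals off [N]. *)
Lemma Rintegral_rdotZ c c' f g : sq_integrable f -> sq_integrable g ->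
  \int[mu]_(x in ~` N) rdot (c *: f x) (c' *: g x) =
  scalar_re (c * scalar_conj c' * L2dot mu f g).
Proof.
move=> If Ig; rewrite /L2dot (scalar_re_integral mN N0).
  by under eq_Rintegral do rewrite /rdot hdotZ.
move=> b; have := integrable_rdot (sq_integrableZ b If) Ig.
by congr (_.-integrable _ _); apply/funext => x; rewrite /rdot linearZl_LR.
Qed.

End SquareIntegrable.

Section Orthogonality.
Context (R : realType) (F : scalar_kind) (d : measure_display)
  (X : measurableType d) (mu : {measure set X -> \bar R})
  (H : X -> hilbertType R F) (E : identification H) (N : set X).
Hypotheses (mN : measurable N) (N0 : mu N = 0%E)
  (cH : countable (range (dim_class H)))
  (mH : forall A, range (dim_class H) A -> measurable (A `\` N)).
Variables (phi : nat -> section H) (a : nat -> scalar_field R F).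
Hypotheses (phi_sq : forall n, (0 < n)%N -> sq_integrable mu E N (phi n))
  (phi_orth : forall m n, (0 < m)%N -> (0 < n)%N ->
    L2dot mu (phi m) (phi n) = (m == n)%:R).

Let mD : measurable (~` N). Proof. exact: measurableC. Qed.

Lemma Rintegral_rdot_term m n : (0 < m)%N -> (0 < n)%N ->
  \int[mu]_(x in ~` N) rdot (a m *: phi m x) (a n *: phi n x) =
  if m == n then rmodulus (a n) ^+ 2 else 0.
Proof.
move=> m0 n0; rewrite (Rintegral_rdotZ mN N0 cH mH _ _ (phi_sq m0) (phi_sq n0)).
rewrite phi_orth//; case: eqP => [->|_]; last by rewrite mulr0 scalar_re0.
by rewrite mulr1 scalar_mul_conj expr2 scalar_reM// -expr2.
Qed.

Lemma sq_integrable_terms s : all (fun n => 0 < n)%N s ->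
  sq_integrable mu E N (fun x => \sum_(n <- s) a n *: phi n x).
Proof.
elim: s => [_|n s IH /= /andP[n0 /IH Is]].
  by apply: eq_sq_integrable (sq_integrable0 mu E N) => x; rewrite big_nil.
have := sq_integrableZD mN cH mH (a n) (phi_sq n0) Is.
by apply: eq_sq_integrable => x; rewrite big_cons.
Qed.

Lemma Rintegral_rdot_sum m s : (0 < m)%N -> m \notin s ->
  all (fun n => 0 < n)%N s ->
  \int[mu]_(x in ~` N) rdot (a m *: phi m x) (\sum_(n <- s) a n *: phi n x) = 0.
Proof.
move=> m0; have Im := sq_integrableZ mN cH mH (a m) (phi_sq m0).
elim: s => [_ _|n s IH].
  under eq_Rintegral do rewrite big_nil /rdot linear0r scalar_re0.
  by rewrite Rintegral_cst// mul0r.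
rewrite inE negb_or => /andP[mn ms] /= /andP[n0 s0].
under eq_Rintegral do rewrite big_cons rdotDr.
rewrite RintegralD//= ?IH//.
- by rewrite Rintegral_rdot_term// (negbTE mn) addr0.
- exact: (integrable_rdot mN cH mH Im (sq_integrableZ mN cH mH _ (phi_sq n0))).
- exact: (integrable_rdot mN cH mH Im (sq_integrable_terms s0)).
Qed.

(** Pythagoras: the head of the list does not recur in the tail, so the cross term integrates to
    zero. *)
Lemma Rintegral_rnorm_sum s : uniq s -> all (fun n => 0 < n)%N s ->
  \int[mu]_(x in ~` N) rnorm (\sum_(n <- s) a n *: phi n x) ^+ 2 =
  \sum_(n <- s) rmodulus (a n) ^+ 2.
Proof.
elim: s => [_ _|n s IH /= /andP[ns us] /andP[n0 s0]].
  under eq_Rintegral do rewrite big_nil rnorm0 expr0n.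
  by rewrite big_nil Rintegral_cst// mul0r.
have In := sq_integrableZ mN cH mH (a n) (phi_sq n0).
have Is := sq_integrable_terms s0.
under eq_Rintegral do rewrite big_cons rnormD_sqr.
have Ins := integrable_rdot mN cH mH In Is.
have I2 := integrableZl mD 2 Ins.
rewrite RintegralD//=; last 2 first.
- exact: (integrableD mD In.2 I2).
- exact: Is.2.
rewrite RintegralD//; [|exact: In.2].
rewrite RintegralZl// Rintegral_rdot_sum// mulr0 addr0 IH// big_cons; congr +%R.
under eq_Rintegral do rewrite rnorm_sqr.
by rewrite Rintegral_rdot_term// eqxx.
Qed.

Lemma integral_rnorm_sum s : uniq s -> all (fun n => 0 < n)%N s ->
  (\int[mu]_(x in ~` N) (rnorm (\sum_(n <- s) a n *: phi n x) ^+ 2)%:E =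
  (\sum_(n <- s) rmodulus (a n) ^+ 2)%:E)%E.
Proof.
move=> us s0; rewrite -Rintegral_rnorm_sum// fineK//.
exact: integrable_fin_num (sq_integrable_terms s0).2.
Qed.

End Orthogonality.

(** * The Rademacher-Menshov inequality *)

(** A sum over the nodes of a binary tree of depth [r]: the root carries [s], its children the two
    consecutive pieces of [s]. *)
Fixpoint dyadic (R : pzSemiRingType) (q : seq nat -> R) (r : nat) (s : seq nat) : R :=
  q s + (if r is r'.+1 then
    dyadic q r' (take (2 ^ r') s) + dyadic q r' (drop (2 ^ r') s) else 0).

Lemma dyadic_ge (R : numDomainType) (q : seq nat -> R) r s :
  (forall s, 0 <= q s) -> q s <= dyadic q r s.
Proof.
move=> q0; elim: r s => [|r IH] s /=; first by rewrite addr0.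
by rewrite lerDl addr_ge0// (le_trans (q0 _) (IH _)).
Qed.

(** Induction on [r]. A prefix either stays in the left piece, or is the whole left piece, of norm
    a, plus a prefix of the right one, of norm b. With t = r + 1, (a + b)^2 <= (t + 1) (a^2 + b^2 /
    t), so the factor grows by one per level. *)
Lemma dyadic_maximal (R : realType) (F : scalar_kind)
    (V : normedModType (scalar_field R F)) (v : nat -> V) (r : nat)
    (s : seq nat) (j : nat) :
  (size s <= 2 ^ r)%N ->
  rnorm (\sum_(n <- take j s) v n) ^+ 2 <=
  r.+1%:R * dyadic (fun s => rnorm (\sum_(n <- s) v n) ^+ 2) r s.
Proof.
set q : seq nat -> R := fun s => _; have q0 s' : 0 <= q s' by rewrite sqr_ge0.
elim: r s j => [|r IH] s j.
  rewrite expn0 mul1r /= addr0 => s1; case: j => [|j].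
    by rewrite take0 big_nil rnorm0 expr0n.
  by rewrite take_oversize// (leq_trans s1).
move=> sr; have szl : (size (take (2 ^ r) s) <= 2 ^ r)%N.
  by rewrite size_take_min geq_minl.
have szr : (size (drop (2 ^ r) s) <= 2 ^ r)%N.
  by rewrite size_drop leq_subLR addnn -mul2n -expnS.
rewrite [dyadic _ _ _]/=; set l := take (2 ^ r) s; set d := drop (2 ^ r) s.
have dl := dyadic_ge r l q0; have dd := dyadic_ge r d q0.
have ql := q0 l; have qd := q0 d; have qs := q0 s.
set P := dyadic q r l in dl *; set Q := dyadic q r d in dd *.
have t0 : 0 < r.+1%:R :> R by rewrite ltr0n.
rewrite -[r.+2%:R]natr1; have [jr|jr] := leqP j (2 ^ r).
  have := IH _ j szl; rewrite take_takel// -/l -/P => H.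
  apply: (le_trans H); set t := r.+1%:R in t0 *.
  have : 0 <= t * Q by rewrite mulr_ge0// ?(ltW t0) ?(le_trans qd dd).
  have : 0 <= t * q s by rewrite mulr_ge0 ?(ltW t0).
  nra.
rewrite -(subnKC (ltnW jr)) takeD -/l -/d big_cat /=.
have := IH d (j - 2 ^ r)%N szr; rewrite -/Q.
have := ler_rnormD (\sum_(n <- l) v n) (\sum_(n <- take (j - 2 ^ r) d) v n).
have : rnorm (\sum_(n <- l) v n) ^+ 2 <= P by [].
move: (rnorm_ge0 (\sum_(n <- l) v n)).
move: (rnorm_ge0 (\sum_(n <- take (j - 2 ^ r) d) v n)).
set a := rnorm (\sum_(n <- l) v n); set b := rnorm (\sum_(n <- take _ _) v n).
set w := rnorm _; set t := r.+1%:R in t0 *; move=> b0 a0 aP wab btQ.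
have w2 : w ^+ 2 <= (a + b) ^+ 2.
  by rewrite ler_sqr ?nnegrE ?addr_ge0 ?rnorm_ge0.
(* AM-GM: [2 a b <= t a^2 + b^2 / t] *)
have ab : 2 * (a * b) <= t * a ^+ 2 + Q.
  by rewrite -(ler_pM2l t0); have := sqr_ge0 (t * a - b); nra.
have : 0 <= t * (P - a ^+ 2) by rewrite mulr_ge0 ?subr_ge0 ?(ltW t0).
have : 0 <= t * q s by rewrite mulr_ge0 ?(ltW t0).
nra.
Qed.

Lemma dyadic_ge0 (R : numDomainType) (q : seq nat -> R) r s :
  (forall s, 0 <= q s) -> 0 <= dyadic q r s.
Proof. by move=> q0; rewrite (le_trans (q0 s)) ?dyadic_ge. Qed.

Lemma all_positive_take_drop s k :
  uniq s -> all (fun n => 0 < n)%N s ->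
  [/\ uniq (take k s), all (fun n => 0 < n)%N (take k s),
      uniq (drop k s) & all (fun n => 0 < n)%N (drop k s)].
Proof.
rewrite -{1 2}(cat_take_drop k s) cat_uniq all_cat.
by move=> /and3P[-> _ ->] /andP[-> ->].
Qed.

Section IntegralDyadic.
Context (R : realType) (d : measure_display) (X : measurableType d)
  (mu : {measure set X -> \bar R}) (D : set X) (mD : measurable D).
Variables (q : X -> seq nat -> R) (b : nat -> R).
Hypotheses (q0 : forall x s, 0 <= q x s)
  (mq : forall s, uniq s -> all (fun n => 0 < n)%N s ->
    measurable_fun D (q ^~ s))
  (Iq : forall s, uniq s -> all (fun n => 0 < n)%N s ->
    (\int[mu]_(x in D) (q x s)%:E = (\sum_(n <- s) b n)%:E)%E).

Lemma measurable_dyadic r s : uniq s -> all (fun n => 0 < n)%N s ->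
  measurable_fun D (fun x => dyadic (q x) r s).
Proof.
elim: r s => [|r IH] s us s0 /=.
  by under eq_fun do rewrite addr0; exact: mq.
have [ut t0 ud d0] := all_positive_take_drop (2 ^ r) us s0.
apply: measurable_funD; first exact: mq.
by apply: measurable_funD; exact: IH.
Qed.

(** Each of the [r + 1] levels of the tree splits [s] into disjoint pieces, hence contributes the
    full sum of [b] over [s]. *)
Lemma integral_dyadic r s : uniq s -> all (fun n => 0 < n)%N s ->
  (\int[mu]_(x in D) (dyadic (q x) r s)%:E =
   (r.+1%:R * \sum_(n <- s) b n)%:E)%E.
Proof.
elim: r s => [|r IH] s us s0 /=.
  by under eq_fun do rewrite addr0; rewrite Iq// mul1r.
have [ut t0 ud d0] := all_positive_take_drop (2 ^ r) us s0.
under eq_fun do rewrite !EFinD.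
have mt := measurable_dyadic r ut t0; have md := measurable_dyadic r ud d0.
rewrite ge0_integralD//; first last.
- by apply: emeasurable_funD; exact/measurable_EFinP.
- by move=> x _; rewrite -EFinD lee_fin addr_ge0 ?dyadic_ge0.
- by apply/measurable_EFinP; exact: mq.
- by move=> x _; rewrite lee_fin.
rewrite ge0_integralD//; first last.
- exact/measurable_EFinP.
- by move=> x _; rewrite lee_fin dyadic_ge0.
- exact/measurable_EFinP.
- by move=> x _; rewrite lee_fin dyadic_ge0.
rewrite Iq// !IH// -!EFinD -mulrDr -big_cat cat_take_drop; congr EFin.
by rewrite -[r.+2%:R]natr1 mulrDl mul1r addrC.
Qed.

End IntegralDyadic.

(** * Blocks and rearrangements *)

(** Since [nu 0 = 2], the indices 1 and 2 lie in no block. *)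
Definition block (k : nat) : pred nat := [pred n | nu k < n <= nu k.+1]%N.

Lemma leq_nu m n : (m <= n)%N -> (nu m <= nu n)%N.
Proof. by move=> mn; rewrite /nu !leq_exp2l. Qed.

Lemma ltn_nu n : (n < nu n)%N.
Proof. by apply: (ltn_trans (ltn_expl n (ltnSn 1))); apply: ltn_expl. Qed.

Lemma sum_blocks (V : nmodType) (v : nat -> V) (s : seq nat) K K' :
  (K <= K')%N ->
  \sum_(n <- s | (nu K < n <= nu K')%N) v n =
  \sum_(K <= k < K') \sum_(n <- s | block k n) v n.
Proof.
move=> /subnK <-; elim: (K' - K)%N => [|m IH].
  rewrite add0n big_geq// big1// => n /andP[Kn].
  by rewrite leqNgt Kn.
rewrite addSn big_nat_recr ?leq_addl//= -IH (bigID (fun n => n <= nu (m + K))%N) /=.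
have KmK := leq_nu (leq_addl m K); have mS := leq_nu (leqnSn (m + K)).
congr +%R; apply: eq_bigl => n; rewrite ?inE -?ltnNge.
  case: (leqP n (nu (m + K))) => nm; rewrite ?andbT ?andbF//.
  by rewrite (leq_trans nm mS) andbT.
rewrite /block /=.
case: (ltnP (nu (m + K)) n) => nm; rewrite ?andbT ?andbF//=.
by rewrite (leq_ltn_trans KmK nm).
Qed.

Section Rearrangement.
Variable sigma : nat -> nat.
Hypothesis sigma_bij : set_bij [set n | (0 < n)%N] [set n | (0 < n)%N] sigma.

Lemma perm_gt0 n : (0 < n)%N -> (0 < sigma n)%N.
Proof. by case: sigma_bij => + _ _ => /(_ _ _); apply. Qed.

Lemma perm_inj m n : (0 < m)%N -> (0 < n)%N -> sigma m = sigma n -> m = n.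
Proof. by case: sigma_bij => _ inj _ m0 n0; apply: inj; rewrite inE. Qed.

Definition perm_seq N := map sigma (iota 1 N).

Lemma perm_seq_uniq N : uniq (perm_seq N).
Proof.
rewrite map_inj_in_uniq ?iota_uniq// => m n.
by rewrite !mem_iota => /andP[m0 _] /andP[n0 _]; apply: perm_inj.
Qed.

Lemma perm_seq_gt0 N : all (fun n => 0 < n)%N (perm_seq N).
Proof.
by apply/allP => _ /mapP[n + ->]; rewrite mem_iota => /andP[n0 _]; exact: perm_gt0.
Qed.

Lemma perm_seqD M N :
  perm_seq (M + N) = perm_seq M ++ map sigma (iota M.+1 N).
Proof. by rewrite /perm_seq iotaD map_cat add1n. Qed.

Lemma perm_seq_exhausts m : exists M, forall n, (0 < n <= m)%N -> n \in perm_seq M.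
Proof.
elim: m => [|m [M IH]]; first by exists 0%N => -[].
have [_ _ /(_ m.+1 (ltn0Sn _))[i i0 im]] := sigma_bij.
(* [M + i] is a common upper bound of [M] and the position [i] of the new index. *)
exists (M + i)%N => n /andP[n0]; rewrite leq_eqVlt => /predU1P[->|].
  by rewrite -im map_f// mem_iota i0 add1n ltnS leq_addl.
by rewrite ltnS perm_seqD mem_cat => nm; rewrite IH// n0.
Qed.

(** All indices up to [m] have occurred by time [M], and by injectivity none occurs again. *)
Lemma perm_seq_tail m M N : (forall n, (0 < n <= m)%N -> n \in perm_seq M) ->
  all (fun n => m < n)%N (map sigma (iota M.+1 N)).
Proof.
move=> exM; apply/allP => n nN; rewrite ltnNge; apply/negP => nm.
have := perm_seq_uniq (M + N); rewrite perm_seqD cat_uniq => /and3P[_ /hasPn].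
move=> /(_ n nN) /negP nM _; apply: nM; apply: exM; rewrite nm andbT.
have := perm_seq_gt0 (M + N); rewrite perm_seqD all_cat => /andP[_ /allP].
exact.
Qed.

(** Whatever [N] is, the terms of a block met so far form a prefix of one fixed list, so
    [dyadic_maximal] bounds them uniformly in [N]. *)
Lemma filter_perm_seq (p : pred nat) m M N : (forall n, p n -> n <= m)%N ->
  (forall n, (0 < n <= m)%N -> n \in perm_seq M) ->
  exists j, seq.filter p (perm_seq N) = take j (seq.filter p (perm_seq M)).
Proof.
move=> pm exM; have [NM|/ltnW MN] := leqP N M.
  exists (size (seq.filter p (perm_seq N))).
  by rewrite -(subnKC NM) perm_seqD filter_cat take_size_cat.
exists (size (seq.filter p (perm_seq M))).
rewrite take_size -(subnKC MN) perm_seqD filter_cat.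
rewrite [X in _ ++ X](_ : _ = [::]) ?cats0//.
apply/eqP; rewrite -(negbK (_ == _)) -has_filter; apply/hasPn => n nN.
by apply/negP => /pm; rewrite leqNgt (allP (perm_seq_tail _ exM) n nN).
Qed.

Lemma filter_perm_seq_perm (p : pred nat) m M :
  (forall n, p n -> 0 < n <= m)%N ->
  (forall n, (0 < n <= m)%N -> n \in perm_seq M) ->
  perm_eq (seq.filter p (perm_seq M)) (seq.filter p (index_iota 0 m.+1)).
Proof.
move=> pm exM; apply: uniq_perm; rewrite ?filter_uniq ?perm_seq_uniq ?iota_uniq//.
move=> n; rewrite !mem_filter; case: (boolP (p n)) => //= /pm nm.
by rewrite exM// mem_index_iota ltnS; case/andP: nm => _ ->.
Qed.

End Rearrangement.

(** * Convergence of a rearranged series from bounds on its blocks *)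

Lemma series_tail_lt (R : realType) (h : nat -> R) (B e : R) :
  (forall k, 0 <= h k) -> (forall n, \sum_(0 <= k < n) h k <= B) -> 0 < e ->
  exists K, forall n, (K <= n)%N -> \sum_(K <= k < n) h k < e.
Proof.
move=> h0 hB e0; have nd : nondecreasing_seq (series h).
  by apply/nondecreasing_seqP => n; rewrite /series /= big_nat_recr//= lerDl.
have /cvg_ex[l hl] : cvgn (series h).
  by apply: (nondecreasing_is_cvgn nd); exists B => _ [n _ <-]; exact: hB.
have hl' n : series h n <= l.
  rewrite -(cvg_lim _ hl)//; apply: nondecreasing_cvgn_le => //.
  exact: cvgP hl.
move/cvgrPdist_lt : hl => /(_ e e0)[K _ /(_ K (leqnn _))] /= hK.
exists K => n Kn; have := hl' n; have := hl' K; move: hK.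
rewrite /series /= => /ltr_normlP[_ hK] _.
by rewrite (big_cat_nat (leq0n K) Kn)//=; lra.
Qed.

(** Cauchy criterion: once all indices up to [nu K] are used, later terms lie in blocks from [K] on.
    Within block [k] an increment is a difference of two partial sums, hence at most [2 * h k]. *)
Lemma cvg_rearrangement (R : realType) (F : scalar_kind)
    (V : completeNormedModType (scalar_field R F)) (v : nat -> V)
    (h : nat -> R) (B : R) (sigma : nat -> nat) :
  set_bij [set n | (0 < n)%N] [set n | (0 < n)%N] sigma ->
  (forall k N, rnorm (\sum_(n <- perm_seq sigma N | block k n) v n) <= h k) ->
  (forall n, \sum_(0 <= k < n) h k <= B) ->
  cvg ((fun N => \sum_(1 <= n < N.+1) v (sigma n)) @ \oo).
Proof.
move=> bij vh hB; have h0 k : 0 <= h k by rewrite (le_trans _ (vh k 0%N)) ?rnorm_ge0.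
have -> : (fun N => \sum_(1 <= n < N.+1) v (sigma n)) =
    (fun N => \sum_(n <- perm_seq sigma N) v n).
  by apply/funext => N; rewrite big_map /index_iota subn1.
apply/cauchy_cvgP/cauchy_exP => e e0.
have e2 : 0 < scalar_re e / 2.
  by rewrite divr_gt0//; have := ltr_scalar_re e0; rewrite scalar_re0.
have [K hK] := series_tail_lt h0 hB e2.
have [M exM] := perm_seq_exhausts bij (nu K).
exists (\sum_(n <- perm_seq sigma M) v n).
exists M => // N /= MN; rewrite -ball_normE /=; apply: ltr_norm_rnorm => //.
rewrite -(subnKC MN) perm_seqD big_cat /= opprD addrA subrr sub0r rnormN.
(* The sum of the entries of [s] bounds each entry, and [n < nu n], so all entries are at most
   [nu K']. *)
set s := map _ _; pose K' := (K + \sum_(n <- s) n)%N.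
have KK' : (K <= K')%N by exact: leq_addr.
have -> : \sum_(n <- s) v n = \sum_(n <- s | (nu K < n <= nu K')%N) v n.
  rewrite [RHS]big_mkcond; apply: eq_big_seq => n ns.
  rewrite (allP (perm_seq_tail bij _ exM) n ns) (_ : (n <= nu K')%N)//.
  rewrite (leq_trans _ (ltnW (ltn_nu _)))// (leq_trans _ (leq_addl _ _))//.
  by rewrite (big_rem n ns) leq_addr.
rewrite sum_blocks// (le_lt_trans (ler_rnorm_sum _ _ _))//.
apply: (@le_lt_trans _ _ (\sum_(K <= k < K') 2 * h k)); last first.
  by rewrite -mulr_sumr mulrC -ltr_pdivlMr// hK.
apply: ler_sum => k _.
have := ler_rnormD (\sum_(n <- perm_seq sigma (M + (N - M)) | block k n) v n)
  (- \sum_(n <- perm_seq sigma M | block k n) v n).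
rewrite rnormN {1}perm_seqD big_cat /= addrAC subrr add0r => /le_trans; apply.
by rewrite mulr_natl mulr2n lerD.
Qed.

(** * Logarithmic weights and summation over the blocks *)

Lemma log2_ge (R : realType) k n : (nu k < n)%N -> 2 ^+ k <= log2 n%:R :> R.
Proof.
move=> kn; have ln2 : 0 < ln 2 :> R by rewrite ln_gt0// ltr1n.
rewrite /log2 ler_pdivlMr//.
have -> : 2 ^+ k * ln 2 = ln (nu k)%:R :> R.
  by rewrite /nu !natrX lnXn // -natrX mulr_natl.
by rewrite ler_ln ?posrE ?ltr0n ?ler_nat ?(ltnW kn) ?(leq_ltn_trans _ kn)
  ?expn_gt0.
Qed.

(** On block [k], 2^(k+1) + 1 <= 3 * 2^k <= 3 log2 n; squaring gives the 9. *)
Lemma block_weight_le (R : realType) (b : nat -> R) k : (forall n, 0 <= b n) ->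
  (2 ^ k.+1).+1%:R ^+ 2 * \sum_((nu k).+1 <= n < (nu k.+1).+1) b n <=
  9 * \sum_((nu k).+1 <= n < (nu k.+1).+1) b n * log2 n%:R ^+ 2.
Proof.
move=> b0; rewrite !mulr_sumr big_nat_cond [leRHS]big_nat_cond.
apply: ler_sum => n /andP[/andP[kn _] _].
have := log2_ge R kn; set L := log2 _ => kL.
have k1 : 1 <= 2 ^+ k :> R by rewrite exprn_ege1// ler1n.
have -> : (2 ^ k.+1).+1%:R = 2 * 2 ^+ k + 1 :> R by rewrite -natr1 natrX exprS.
rewrite mulrCA [leLHS]mulrC; apply: ler_wpM2l => //.
have -> : 9 * L ^+ 2 = (3 * L) ^+ 2 by ring.
by rewrite ler_sqr ?nnegrE; lra.
Qed.

Lemma sum_inv_pow2_le (R : realType) n : \sum_(0 <= k < n) (1 / 2) ^+ k <= 2 :> R.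
Proof.
suff -> : \sum_(0 <= k < n) (1 / 2) ^+ k = 2 - 2 * (1 / 2) ^+ n :> R.
  by rewrite gerBl mulr_ge0// exprn_ge0// divr_ge0.
elim: n => [|n IH]; first by rewrite big_geq// expr0; lra.
by rewrite big_nat_recr//= IH exprS; lra.
Qed.

Lemma nneseries_partial_le (R : realType) (f : nat -> R) :
  (forall k, 0 <= f k) -> (\sum_(0 <= k <oo) (f k)%:E < +oo)%E ->
  exists B, forall n, \sum_(0 <= k < n) f k <= B.
Proof.
move=> f0 foo; exists (fine (\sum_(0 <= k <oo) (f k)%:E)%E) => n.
have fE k : (0 <= k)%N -> true -> (0 <= (f k)%:E)%E by rewrite lee_fin.
rewrite -lee_fin fineK; last first.
  by rewrite ge0_fin_numE// nneseries_ge0.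
by rewrite -sumEFin; exact: nneseries_lim_ge.
Qed.

(** AM-GM with weight [c] replaces the triangle inequality in L2: a square-integrable bound becomes
    a constant plus an integrable function, which also serves when [mu] is infinite. *)
Lemma abs_le_weighted (R : realFieldType) (c t S : R) : 0 < c -> t ^+ 2 <= S ->
  t <= (c + S / c) / 2.
Proof.
move=> c0 tS; have tSc : t ^+ 2 / c <= S / c by rewrite ler_pM2r ?invr_gt0.
have : 0 <= (c - t) ^+ 2 / c by rewrite mulr_ge0 ?sqr_ge0// invr_ge0 ltW.
have -> : (c - t) ^+ 2 / c = c + t ^+ 2 / c - 2 * t by field; rewrite gt_eqF.
by lra.
Qed.

Theorem theorem2 (R : realType) (F : scalar_kind)
    (d : measure_display) (X : measurableType d)
    (mu : {measure set X -> \bar R})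
    (H : X -> hilbertType R F) (E : identification H)
    (phi : nat -> section H) (a : nat -> scalar_field R F) :
  measurable_collection mu H ->
  orthonormal_system mu E phi ->
  (\sum_(0 <= k <oo)
     (Num.sqrt (\sum_((nu k).+1 <= n < (nu k.+1).+1)
        rmodulus (a n) ^+ 2 * log2 n%:R ^+ 2))%:E < +oo)%E ->
  unconditionally_cvg_ae mu (fun n x => a n *: phi n x).
Proof.
move=> mH [phiL2 phi_orth] aoo sigma bij.
have [N [mN N0 mA mphi]] := exists_null_set mH (fun n n0 => (phiL2 n n0).1).
have cH := mH.1.
have phi_sq n : (0 < n)%N -> sq_integrable mu E N (phi n).
  move=> n0; split; first exact: mphi.
  have mr := measurable_rnorm cH mA (mphi n n0).
  apply/integrableP; split; first exact/measurable_EFinP/measurable_funX.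
  have := (phiL2 n n0).2; rewrite (integral_setC_null mN N0); congr (_ < _)%E.
  by apply: eq_integral => x _; rewrite gee0_abs// lee_fin sqr_ge0.
have mD : measurable (~` N) by exact: measurableC.
pose b n := rmodulus (a n) ^+ 2.
have b0 n : 0 <= b n by exact: sqr_ge0.
pose q x s := rnorm (\sum_(n <- s) a n *: phi n x) ^+ 2.
have q0 x s : 0 <= q x s by exact: sqr_ge0.
have mq s (us : uniq s) (s0 : all (fun n => 0 < n)%N s) :
    measurable_fun (~` N) (q ^~ s).
  have [ms _] := sq_integrable_terms mN cH mA a phi_sq s0.
  exact/measurable_funX/(measurable_rnorm cH mA ms).
have Iq s (us : uniq s) (s0 : all (fun n => 0 < n)%N s) :=
  integral_rnorm_sum mN N0 cH mA a phi_sq phi_orth us s0.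
have /choice[M exM] k := perm_seq_exhausts bij (nu k.+1).
pose L k := [seq n <- perm_seq sigma (M k) | block k n].
have uL k : uniq (L k) by rewrite filter_uniq// perm_seq_uniq.
have L0 k : all (fun n => 0 < n)%N (L k).
  rewrite all_filter (sub_all _ (perm_seq_gt0 bij _))// => n /= ->.
  by rewrite implybT.
have blockP k n : block k n -> (0 < n <= nu k.+1)%N.
  by move=> /andP[/(leq_ltn_trans (leq0n _)) -> ->].
have L_perm k : perm_eq (L k) [seq n <- index_iota 0 (nu k.+1).+1 | block k n].
  exact: filter_perm_seq_perm (blockP k) (exM k).
(* The block lies in 1, ..., [nu k.+1], so a tree of depth [2 ^ k.+1] is deep enough. *)
have sL k : (size (L k) <= 2 ^ 2 ^ k.+1)%N.
  rewrite -/(nu k.+1) -[X in (_ <= X)%N](size_iota 1) uniq_leq_size//.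
  by move=> n; rewrite mem_filter => /andP[/blockP]; rewrite mem_iota add1n ltnS.
have sumL k : \sum_(n <- L k) b n = \sum_((nu k).+1 <= n < (nu k.+1).+1) b n.
  rewrite (perm_big _ (L_perm k)) big_filter [RHS](big_nat_widenl _ 0%N)//.
  rewrite big_nat_cond [RHS]big_nat_cond; apply: eq_bigl => n.
  by rewrite /block /= ltnS; case: (n <= nu k.+1)%N; rewrite ?andbT ?andbF.
pose r k := (2 ^ k.+1)%N.
pose A k := Num.sqrt (\sum_((nu k).+1 <= n < (nu k.+1).+1) b n * log2 n%:R ^+ 2).
have A0 k : 0 <= A k by exact: sqrtr_ge0.
(* The geometric term makes [c k] positive even if [A k = 0], and adds at most 2 to the partial
   sums. *)
pose c k := A k + (1 / 2) ^+ k.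
have c0 k : 0 < c k by rewrite ltr_wpDl// exprn_gt0// divr_gt0.
pose S k x := (r k).+1%:R * dyadic (q x) (r k) (L k).
have S0 k x : 0 <= S k x by rewrite mulr_ge0 ?dyadic_ge0.
have mS k : measurable_fun (~` N) (S k).
  exact/measurable_funM/measurable_dyadic.
(* The integral of [S k] is at most [9 * A k ^+ 2], and [A k <= c k]. *)
have IS k : (\int[mu]_(x in ~` N) (S k x / c k)%:E <= (9 * A k)%:E)%E.
  under eq_fun do rewrite mulrC mulrA EFinM.
  rewrite ge0_integralZl_EFin//; last first.
  - by rewrite mulr_ge0// invr_ge0 ltW.
  - by apply/measurable_EFinP; exact: measurable_dyadic.
  - by move=> x _; rewrite lee_fin dyadic_ge0.
  rewrite (integral_dyadic mD q0 mq Iq)// sumL -EFinM lee_fin.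
  rewrite -mulrA ler_pdivrMl// mulrA -expr2.
  apply: (le_trans (block_weight_le k b0)).
  rewrite -[X in 9 * X <= _]sqr_sqrtr; last first.
    by apply: sumr_ge0 => n _; rewrite mulr_ge0 ?sqr_ge0.
  by rewrite -/(A k) expr2 [leRHS]mulrCA ler_wpM2l// ler_wpM2r// lerDl exprn_ge0
    ?divr_ge0.
have SE0 k x : (0 <= (S k x / c k)%:E)%E by rewrite lee_fin divr_ge0// ltW.
have mSE k : measurable_fun (~` N) (fun x => (S k x / c k)%:E).
  by apply/measurable_EFinP; exact: measurable_funM.
have ISoo : (\int[mu]_(x in ~` N) (\sum_(0 <= k <oo) (S k x / c k)%:E) < +oo)%E.
  rewrite integral_nneseries//.
  apply: (@le_lt_trans _ _ (\sum_(0 <= k <oo) (9%:E * (A k)%:E))%E).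
    by apply: lee_nneseries => // k _ _; exact: integral_ge0.
  by rewrite nneseriesZl ?lte_mul_pinfty// => k _; rewrite lee_fin.
have [Bc hBc] : exists B, forall n, \sum_(0 <= k < n) c k <= B.
  have [B hB] := nneseries_partial_le A0 aoo.
  by exists (B + 2) => n; rewrite big_split lerD//= sum_inv_pow2_le.
have : {ae mu, forall x, (~` N) x ->
    (\sum_(0 <= k <oo) (S k x / c k)%:E)%E \is a fin_num}.
  apply: integrable_ae => //; apply/integrableP; split.
    exact: ge0_emeasurable_sum.
  by under eq_integral do rewrite gee0_abs ?nneseries_ge0//.
have : {ae mu, forall x, (~` N) x} by exists N; split => // x /contrapT.
apply: filterS2 => x Nx /(_ Nx) Sfin.
have [BS hBS] : exists B, forall n, \sum_(0 <= k < n) S k x / c k <= B.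
  apply: nneseries_partial_le => [k|]; first by rewrite divr_ge0// ltW.
  by rewrite ltey_eq Sfin.
(* Both [c k] and, at this [x], [S k x / c k] have bounded partial sums, hence so does their half
   sum. *)
apply: (@cvg_rearrangement _ _ (H x) (fun n => a n *: phi n x)
  (fun k => (c k + S k x / c k) / 2) ((Bc + BS) / 2)) => // [k N'|n]; last first.
  by rewrite -mulr_suml big_split ler_pM2r// lerD.
apply: abs_le_weighted => //; rewrite -big_filter.
have pk n : block k n -> (n <= nu k.+1)%N by move=> /blockP/andP[].
have [j ->] := filter_perm_seq bij N' pk (exM k).
exact: (dyadic_maximal (fun n => a n *: phi n x) j (sL k)).
Qed.
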